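(* Let $\mathcal I\subseteq\mathbb N$ be an at most countable index set and let $(F_S)$, indexed by the finite nonempty sets $S\subseteq\mathcal I$, be a family such that every $F_S:[0,\infty)^S\to[0,\infty)$ is an admissible pointwise $e$-process merger. Suppose the family is future-extension coherent under neutral padding: $$F_B(x_B)\le F_S\big(x_B,\mathbf 1_{S\setminus B}\big)\qquad\text{for all finite nonempty }B\subseteq S\subseteq\mathcal I\text{ and every }x_B\in[0,\infty)^B .$$ Then there is a unique family of weights $(w_i)_{i\in\mathcal I}$ satisfying $w_i\ge0$ for all $i$ and $\sum_{i\in\mathcal I}w_i\le1$ such that, for every finite nonempty $S\subseteq\mathcal I$ and every $x_S\in[0,\infty)^S$, $$F_S(x_S)=1+\sum_{i\in S}w_i(x_i-1).$$ In particular, the coherence inequality necessarily holds with equality: $F_S(x_B,\mathbf 1_{S\setminus B})=F_B(x_B)$ for all finite nonempty $B\subseteq S$ and all $x_B\in[0,\infty)^B$. The weights are identified by the singleton merger rules; for example $w_i=F_{\{i\}}(2)-1=1-F_{\{i\}}(0)$.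
   Context: Here $(x_B,\mathbf 1_{S\setminus B})\in[0,\infty)^S$ is the vector whose coordinates in $B$ are those of $x_B$ and whose coordinates in $S\setminus B$ all equal one. A nonnegative adapted process $E=(E_t)_{t\in\mathbb N_0}$ on a filtered measurable space with filtration $(\mathcal F_t)_{t\in\mathbb N_0}$ is an $e$-process for a null hypothesis $H$ (a set of probability measures), or $H$-$e$-process, if $\mathbb E_P[E_\tau]\le1$ for every $P\in H$ and every $(\mathcal F_t)$-stopping time $\tau$ with $P(\tau<\infty)=1$. For a finite nonempty set $S$, an increasing (coordinatewise nondecreasing) Borel map $F:[0,\infty)^S\to[0,\infty)$ is a pointwise $e$-process merger if, for every filtered statistical model (discrete-time filtered measurable space with a family of probability measures), every null hypothesis $H$, and every tuple $(M^i)_{i\in S}$ of $H$-$e$-processes in the same filtration, the process $t\mapsto F((M^i_t)_{i\in S})$ is an $H$-$e$-process. A pointwise $e$-process merger $F$ is admissible if there is no other pointwise $e$-process merger $G$ on the same domain with $G\ge F$ everywhere and $G>F$ at some point. *)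

(* Defs.v *)
From HB Require Import structures.
From mathcomp Require Import all_boot all_order all_algebra finmap.
From mathcomp Require Import all_classical all_reals all_analysis.

Set Implicit Arguments.
Unset Strict Implicit.
Unset Printing Implicit Defensive.

Import Order.TTheory GRing.Theory Num.Theory numFieldNormedType.Exports.

Local Open Scope classical_set_scope.
Local Open Scope ring_scope.

Section EProcesses.
Context {R : realType} {d : measure_display} {T : measurableType d}.
Implicit Types (Ft : nat -> set (set T)) (E : nat -> T -> R).

Definition is_filtration Ft : Prop :=
  [/\ forall n, sigma_algebra setT (Ft n),
      forall n, Ft n `<=` measurable &
      forall m n, (m <= n)%N -> Ft m `<=` Ft n].

Definition adapted Ft E : Prop :=
  forall n (A : set R), measurable A -> Ft n (E n @^-1` A).

(* Random times take values in [option nat], [None] standing for infinity. *)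
Definition is_stopping_time Ft (tau : T -> option nat) : Prop :=
  forall n, Ft n [set w | exists2 k, tau w = Some k & (k <= n)%N].

(* The value 0 on {tau = oo} is immaterial: below this event is null. *)
Definition stopped E (tau : T -> option nat) (w : T) : R :=
  if tau w is Some n then E n w else 0.

Definition is_e_process Ft (H : set (probability T R)) E : Prop :=
  [/\ forall n w, 0 <= E n w,
      adapted Ft E &
      forall (P : probability T R) (tau : T -> option nat),
        H P -> is_stopping_time Ft tau ->
        P [set w | isSome (tau w)] = 1%E ->
        ('E_P[stopped E tau] <= 1)%E].

End EProcesses.

Section Mergers.
Context {R : realType} {S : finType}.
Implicit Types F G : (S -> R) -> R.

Definition orthant : set (S -> R) := [set x | forall i, 0 <= x i].

(* R^S with the Borel sigma-algebra of the product topology. *)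
Definition borel_space : Type := g_sigma_algebraType (@open {ptws S -> R}).

(* A map [0,oo)^S -> [0,oo) is represented by a function on R^S; nothing below
   depends on its values outside the orthant. *)
Definition is_increasing_borel_map F : Prop :=
  [/\ forall x, orthant x -> 0 <= F x,
      forall x y, orthant x -> orthant y -> (forall i, x i <= y i) ->
        F x <= F y &
      measurable_fun (orthant : set borel_space) (F : borel_space -> R)].

(* [PP] is the family of probability measures of the filtered statistical
   model, [H] the null hypothesis. *)
Definition is_pointwise_merger F : Prop :=
  is_increasing_borel_map F /\
  forall (d : measure_display) (T : measurableType d)
    (Ft : nat -> set (set T)) (PP H : set (probability T R))
    (M : S -> nat -> T -> R),
    is_filtration Ft -> H `<=` PP ->
    (forall i, is_e_process Ft H (M i)) ->
    is_e_process Ft H (fun t w => F (fun i => M i t w)).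

Definition is_admissible F : Prop :=
  is_pointwise_merger F /\
  ~ exists G, [/\ is_pointwise_merger G,
      forall x, orthant x -> F x <= G x &
      exists2 x, orthant x & F x < G x].

End Mergers.

Section Padding.
Context {R : realType} {K : choiceType}.

(* [insub] recovers i as an element of B when i \in B. *)
Definition pad_one (B S : {fset K}) (x : B -> R) : S -> R :=
  fun i => if insub (val i) is Some j then x j else 1.

End Padding.
Arguments pad_one {R K B} S x.

Section Families.
Context {R : realType} {I : set nat}.

Definition is_weight_family (F : forall S : {fset I}, (S -> R) -> R)
    (w : I -> R) : Prop :=
  [/\ forall i, 0 <= w i,
      (\esum_(i in [set: I]) (w i)%:E <= 1)%E &
      forall (S : {fset I}) (x : S -> R), S != fset0 -> orthant x ->
        F S x = 1 + \sum_(i : S) w (val i) * (x i - 1)].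

End Families.

(* Main.v *)
From HB Require Import structures.
Require Import Defs.
From mathcomp Require Import all_boot all_order all_algebra finmap.
From mathcomp Require Import all_classical all_reals all_analysis.
From mathcomp Require Import measurable_realfun lra.

Import Order.TTheory GRing.Theory Num.Theory numFieldNormedType.Exports.

Local Open Scope classical_set_scope.
Local Open Scope fset_scope.
Local Open Scope ring_scope.

Set Implicit Arguments.
Unset Strict Implicit.
Unset Printing Implicit Defensive.

(** Call an affine map neutral when its value at the all-ones vector is 1, that
    is, when it has the form 1 + sum_i l_i (x_i - 1). The heart of the matter
    is that an admissible merger agrees on the orthant with such a map, with
    l >= 0 and sum_i l_i <= 1 ([admissible_eq_affine]).

    The argument is a hyperplane separation. Feeding a merger F with processes
    that are constant in time but random shows that every finitely supported law
    on the orthant whose mean is at most 1 in each coordinate gives F a mean at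
    most 1 ([merger_finite_mean]). Equivalently, the convex cone generated by the
    points (x - 1, F x - 1) contains no (u, v) with u <= 0 < v
    ([excess_cone_neg]). The origin x = 0 is a Slater point, so the separating
    hyperplane is not vertical ([cone_supporting_functional]): there is l >= 0
    with F x - 1 <= sum_i l_i (x_i - 1) for all x, and x = 0 yields
    sum_i l_i <= 1 ([merger_le_affine]). This affine majorant is itself a
    merger, because an expectation commutes with positive affine combinations
    ([neutral_affine_merger]), so an admissible F is equal to it.

    Coherence then ties the slopes of different index sets together. Padding
    the constant c from {i} to S compares 1 + w_i (c - 1) with
    1 + l_i (c - 1), where w_i is the slope of the rule for {i} and l_i that of
    the rule for S. The point 1 is interior to the half-line, so taking c on
    either side of it turns the inequality into l_i = w_i
    ([coherent_weights]). The finite sums of w are thus at most 1, hence so is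
    their supremum. *)

(** * Supporting functionals of convex cones *)

(** A Hahn-Banach argument that treats one coordinate at a time. The slope l_j
    of the first coordinate must dominate v / u_j for the elements of the cone
    with u_j > 0 and be dominated by v / u_j for those with u_j < 0, all of them
    with the other coordinates nonpositive; these two families are separated
    because combining two such elements so as to cancel coordinate j stays in
    the cone. Subtracting l_j u_j from v then removes the coordinate. The
    element with negative coordinates bounds the first family. *)
Lemma cone_supporting_functional (R : realType) (S : eqType)
    (C : (S -> R) -> R -> Prop) (s : seq S) :
  uniq s ->
  (forall u v u' v', C u v -> C u' v' ->
    C (fun i => u i + u' i) (v + v')) ->
  (forall a u v, 0 < a -> C u v -> C (fun i => a * u i) (a * v)) ->
  (exists u v, C u v /\ forall i, i \in s -> u i < 0) ->
  (forall u v, C u v -> (forall i, i \in s -> u i <= 0) -> v <= 0) ->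
  exists l : S -> R, (forall i, 0 <= l i) /\
    forall u v, C u v -> v <= \sum_(i <- s) l i * u i.
Proof.
elim: s C => [|j s IH] C.
  move=> _ _ _ _ neg; exists (fun=> 0); split=> // u v Cuv.
  by rewrite big_nil; apply: (neg u v Cuv) => i; rewrite in_nil.
move=> /= /andP[js us] addC scaleC [u0 [v0 [C0 u0_lt0]]] neg.
have u0j : u0 j < 0 by apply: u0_lt0; rewrite inE eqxx.
have u0s i : i \in s -> u0 i < 0 by move=> si; apply: u0_lt0; rewrite inE si orbT.
(* Throwing in 0 makes A nonempty and its supremum nonnegative. *)
pose A : set R := [set r | r = 0 \/ exists u v,
  [/\ C u v, 0 < u j, forall i, i \in s -> u i <= 0 & r = v / u j]].
(* The combination - u'_j (u, v) + u_j (u', v') has positive coefficients and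
   cancels the coordinate j. *)
have A_ub u' v' : C u' v' -> u' j < 0 -> (forall i, i \in s -> u' i <= 0) ->
    ubound A (v' / u' j).
  move=> C' u'j u's r [->|[u [v [Cuv uj us0 ->]]]].
    rewrite -mulrNN mulr_ge0//; last by rewrite oppr_ge0 invr_le0 ltW.
    rewrite oppr_ge0; apply: (neg _ _ C') => i; rewrite inE => /orP[/eqP->|/u's//].
    exact: ltW.
  have : - u' j * v + u j * v' <= 0.
    apply: (neg (fun i => - u' j * u i + u j * u' i)).
      by apply: addC; apply: scaleC => //; rewrite oppr_gt0.
    move=> i; rewrite inE => /orP[/eqP->|si]; first by rewrite mulNr mulrC addNr.
    have := us0 i si; have := u's i si.
    by move=> h1 h2; nra.
  rewrite ler_pdivrMr// mulrAC ler_ndivlMr//.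
  lra.
have A0 : A 0 by left.
have supA : has_sup A.
  split; first by exists 0.
  exists (v0 / u0 j); apply: A_ub => // i si; exact/ltW/u0s.
pose lj := sup A.
have lj0 : 0 <= lj by exact: sup_upper_bound.
have [l [l0 lP]] : exists l : S -> R, (forall i, 0 <= l i) /\
    forall u v, C u (v + lj * u j) -> v <= \sum_(i <- s) l i * u i.
  apply: (IH (fun u v => C u (v + lj * u j)) us).
  - move=> u v u' v' Cu Cu'.
    by rewrite (_ : _ + _ = (v + lj * u j) + (v' + lj * u' j)); [exact: addC|lra].
  - move=> a u v a0 Cu.
    by rewrite (_ : _ + _ = a * (v + lj * u j)); [exact: scaleC|lra].
  - by exists u0, (v0 - lj * u0 j); split=> //; rewrite subrK.
  - move=> u v Cuv us0; have [uj|uj|uj] := ltgtP (u j) 0.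
    + have : lj <= (v + lj * u j) / u j.
        by apply: ge_sup; [exists 0|apply: A_ub].
      by rewrite ler_ndivlMr//; lra.
    + have : (v + lj * u j) / u j <= lj.
        by apply: sup_upper_bound => //; right; exists u, (v + lj * u j).
      by rewrite ler_pdivrMr//; lra.
    + move: Cuv; rewrite uj mulr0 addr0 => /neg; apply => i.
      by rewrite inE => /orP[/eqP->|/us0//]; rewrite uj.
exists (fun i => if i == j then lj else l i); split=> [i|u v Cuv].
  by case: ifP.
rewrite big_cons eqxx -lerBlDl.
rewrite (eq_big_seq (fun i => l i * u i)).
  by apply: lP; rewrite subrK.
by move=> i si; case: eqP => // ij; rewrite -ij si in js.
Qed.

(** * What a merger does to finitely supported laws *)

(** The law puts mass [q k] at k, so that indices rather than vectors are
    random; a law on vectors arises from it by composition. *)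
Lemma finite_law_exists (R : realType) (n : nat) (q : nat -> {nonneg R}) :
  \sum_(k < n) (q k)%:num = 1 ->
  exists P : probability nat R, forall f : nat -> R, (forall k, 0 <= f k) ->
    (\int[P]_k (f k)%:E = (\sum_(k < n) (q k)%:num * f k)%:E)%E.
Proof.
move=> q1.
pose m := msum (fun k => mscale (q k) (\d_k : measure nat R)) n.
have m1 : m setT = 1%E.
  rewrite /m /msum /= -q1 -sumEFin; apply: eq_bigr => k _.
  by rewrite /mscale/= diracT mule1.
have [P PE] : exists P : probability nat R, (P : set nat -> \bar R) = m.
  by exists (HB.pack_for (probability nat R)
    (msum (fun k => mscale (q k) (\d_k : measure nat R)) n)
    (Measure_isProbability.Build _ _ _ m m1)).
exists P => f f0.
rewrite PE /m ge0_integral_measure_sum//; last by move=> k _; rewrite lee_fin.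
rewrite -sumEFin; apply: eq_bigr => k _.
rewrite ge0_integral_mscale//=; last by move=> j _; rewrite lee_fin.
rewrite [X in (_ * X)%E](_ : _ = (f k)%:E) ?EFinM//.
have mf : measurable_fun setT (fun j : nat => (f j)%:E) by [].
by have := integral_dirac (k : nat) measurableT mf; rewrite diracT mul1e.
Qed.

(** The random index is revealed at time 0 and the processes are constant in
    time, so stopping them cannot help: being e-processes is just the bound on
    the means. The merged process at time 0 gives the conclusion. *)
Lemma merger_finite_mean (R : realType) (S : finType) (F : (S -> R) -> R)
    (s : seq ({nonneg R} * (S -> {nonneg R}))) :
  is_pointwise_merger F -> \sum_(p <- s) p.1%:num = 1 ->
  (forall i, \sum_(p <- s) p.1%:num * (p.2 i)%:num <= 1) ->
  \sum_(p <- s) p.1%:num * F (fun i => (p.2 i)%:num) <= 1.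
Proof.
move=> [[F0 _ _] mergeF] s1 smean.
pose zero : {nonneg R} := NngNum (lexx 0).
pose z : {nonneg R} * (S -> {nonneg R}) := (zero, fun=> zero).
pose q k := (nth z s k).1.
pose X k i := ((nth z s k).2 i)%:num.
have X0 k i : 0 <= X k i by rewrite /X.
have q1 : \sum_(k < size s) (q k)%:num = 1.
  by rewrite -s1 (big_nth z) big_mkord.
have [P PE] := finite_law_exists q1.
pose Ft : nat -> set (set nat) := fun=> setT.
have filt : is_filtration Ft by split=> // n; split.
have eX i : is_e_process Ft [set P]%classic (fun _ w => X w i).
  split=> // _ tau -> _ _.
  rewrite unlock; apply: (@le_trans _ _ (\int[P]_k (X k i)%:E)%E).
    apply: ge0_le_integral => //.
    - by move=> k _; rewrite lee_fin /stopped; case: (tau k).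
    - by move=> k _; rewrite lee_fin /stopped; case: (tau k).
  rewrite PE//.
  by rewrite lee_fin; have := smean i; rewrite (big_nth z) big_mkord.
have [_ _ /(_ P (fun=> Some 0%N) erefl)] :=
  mergeF _ _ Ft [set P]%classic [set P]%classic _ filt (fun _ h => h) eX.
rewrite (_ : [set w | isSome _]%classic = setT); last by apply/seteqP; split.
move=> /(_ _ (probability_setT P)).
rewrite unlock PE; last by move=> k; apply: F0.
by rewrite lee_fin (big_nth z) big_mkord; apply.
Qed.

(** * Neutral affine maps are mergers *)

Lemma stopped_measurable (R : realType) (d : measure_display)
    (T : measurableType d) (Ft : nat -> set (set T)) (E : nat -> T -> R)
    (tau : T -> option nat) :
  is_filtration Ft -> adapted Ft E -> is_stopping_time Ft tau ->
  measurable_fun setT (stopped E tau).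
Proof.
move=> [_ Ftm _] adE st _ B mB; rewrite setTI.
have m_eq n : measurable [set w | tau w = Some n].
  have -> : [set w | tau w = Some n] =
      ([set w | exists2 k, tau w = Some k & (k <= n)%N] `\`
       [set w | exists2 k, tau w = Some k & (k < n)%N])%classic.
    apply/seteqP; split=> w /=.
      by move=> ->; split; [exists n|case=> k [<-]; rewrite ltnn].
    case=> -[k -> kn] nk; congr Some; apply/eqP; rewrite eqn_leq kn leqNgt.
    by apply/negP => kn'; apply: nk; exists k.
  apply: measurableD; first exact/(Ftm n)/st.
  case: n => [|n]; last exact/(Ftm n)/st.
  by rewrite (_ : [set _ | _] = set0)// -subset0 => w [].
have -> : (stopped E tau @^-1` B =
    (\bigcup_n ([set w | tau w = Some n] `&` E n @^-1` B)) `|`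
    (~` (\bigcup_n [set w | tau w = Some n]) `&` [set _ | B 0]))%classic.
  apply/seteqP; split=> w; rewrite /preimage /stopped /=.
    case tw: (tau w) => [n|] Bw; first by left; exists n.
    by right; split=> // -[n _] /=; rewrite tw.
  case=> [[n _ /= [-> //]]|[nw Bw]].
  by case tw: (tau w) => [n|//]; exfalso; apply: nw; exists n.
apply: measurableU.
  by apply: bigcup_measurable => n _; apply: measurableI => //; apply/(Ftm n)/adE.
apply: measurableI; first exact/measurableC/bigcup_measurable.
have [B0|B0] := pselect (B 0).
  by rewrite (_ : [set _ | _] = setT)//; apply/seteqP; split.
by rewrite (_ : [set _ | _] = set0)// -subset0 => w.
Qed.

Definition neutral_affine {R : realType} {S : finType} (l x : S -> R) : R :=
  1 + \sum_i l i * (x i - 1).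

(** The form in which positivity, monotonicity and the passage to expectations
    are visible: when l >= 0 and sum_i l_i <= 1, a nonnegative constant plus a
    nonnegative combination. *)
Lemma neutral_affineE (R : realType) (S : finType) (l x : S -> R) :
  neutral_affine l x = (1 - \sum_i l i) + \sum_i l i * x i.
Proof.
rewrite /neutral_affine -addrA; congr (_ + _); rewrite addrC -sumrB.
by apply: eq_bigr => i _; rewrite mulrBr mulr1.
Qed.

Lemma adapted_neutral_affine (R : realType) (S : finType) (l : S -> R)
    (d : measure_display) (T : measurableType d) (Ft : nat -> set (set T))
    (M : S -> nat -> T -> R) :
  is_filtration Ft -> (forall i, adapted Ft (M i)) ->
  adapted Ft (fun t w => neutral_affine l (fun i => M i t w)).
Proof.
move=> [sa _ _] adM n A mA.
(* Ft n is made the sigma-algebra of a type of its own, on which the closure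
   properties of measurable functions apply. *)
pose Tn := g_sigma_algebraType (Ft n).
have mE (B : set T) : @measurable _ Tn B = Ft n B.
  by rewrite /measurable/= sigma_algebra_id.
rewrite -mE.
have mM i : measurable_fun setT (M i n : Tn -> R).
  by move=> _ B mB; rewrite setTI mE; apply: adM.
have : measurable_fun setT
    ((fun w => neutral_affine l (fun i => M i n w)) : Tn -> R).
  apply: measurable_funD => //; apply: measurable_sum => i.
  by apply: measurable_funM => //; apply: measurable_funB.
by move=> /(_ measurableT _ mA); rewrite setTI.
Qed.

Lemma neutral_affine_increasing_borel (R : realType) (S : finType) (l : S -> R) :
  (forall i, 0 <= l i) -> \sum_i l i <= 1 ->
  is_increasing_borel_map (neutral_affine l).
Proof.
move=> l0 l1; split.
- move=> x x0; rewrite neutral_affineE addr_ge0 ?subr_ge0//.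
  by apply: sumr_ge0 => i _; rewrite mulr_ge0.
- move=> x y x0 y0 xy; rewrite !neutral_affineE lerD2l.
  by apply: ler_sum => i _; rewrite ler_wpM2l.
- have mproj i : measurable_fun setT ((fun x => x i) : @borel_space R S -> R).
    apply: (measurability _ (RGenOpens.measurableE R)).
    move=> _ [_ [a [b ->]] <-]; rewrite setTI; apply: sub_sigma_algebra.
    apply: open_comp; last exact: interval_open.
    move=> x _; exact: (@proj_continuous S (fun=> R) i x).
  apply: measurable_funTS.
  apply: measurable_funD => //; apply: measurable_sum => i.
  by apply: measurable_funM => //; apply: measurable_funB.
Qed.

(** Expectation is additive on nonnegative measurable functions, and the stopped
    processes have expectation at most 1, whence
    (1 - sum_i l_i) + sum_i l_i = 1 as a bound. *)
Lemma neutral_affine_merger (R : realType) (S : finType) (l : S -> R) :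
  (forall i, 0 <= l i) -> \sum_i l i <= 1 ->
  is_pointwise_merger (neutral_affine l).
Proof.
move=> l0 l1; split; first exact: neutral_affine_increasing_borel.
move=> d T Ft PP H M filt HPP eM.
have adM i : adapted Ft (M i) by have [] := eM i.
have M0 i n w : 0 <= M i n w by have [+ _ _] := eM i; apply.
have stop0 (tau : T -> option nat) i w : 0 <= stopped (M i) tau w.
  by rewrite /stopped; case: (tau w).
split=> [n w||P tau HP st Pfin].
- by have [h _ _] := neutral_affine_increasing_borel l0 l1; apply: h => i.
- exact: adapted_neutral_affine.
pose c := 1 - \sum_i l i.
have c0 : 0 <= c by rewrite subr_ge0.
have mst i : measurable_fun setT (stopped (M i) tau).
  exact: stopped_measurable filt (adM i) st.
rewrite unlock.
(* Only an inequality: where tau is infinite the stopped process is 0, while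
   the combination of the stopped processes still contains the constant c. *)
apply: (@le_trans _ _ (\int[P]_w (c%:E + \sum_i (l i * stopped (M i) tau w)%:E)%E)%E).
  apply: ge0_le_integral => //.
  - move=> w _; rewrite lee_fin /stopped; case: (tau w) => // n.
    by have [h _ _] := neutral_affine_increasing_borel l0 l1; apply: h => i.
  - apply/measurable_EFinP; apply: (stopped_measurable filt _ st).
    exact: adapted_neutral_affine.
  - apply: emeasurable_funD => //; apply: emeasurable_sum => i.
    by apply/measurable_EFinP; apply: measurable_funM.
  - move=> w _; rewrite sumEFin -EFinD lee_fin {1}/stopped.
    case tw: (tau w) => [n|].
      rewrite neutral_affineE lerD2l; apply: ler_sum => i _.
      by rewrite /stopped tw.
    by rewrite addr_ge0// sumr_ge0// => i _; rewrite mulr_ge0.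
rewrite ge0_integralD//; last 2 first.
  - by move=> w _; rewrite sume_ge0// => i _; rewrite lee_fin mulr_ge0.
  - apply: emeasurable_sum => i.
    by apply/measurable_EFinP; apply: measurable_funM.
rewrite integral_cst//= probability_setT mule1.
rewrite ge0_integral_sum//; last 2 first.
  - by move=> i; apply/measurable_EFinP; apply: measurable_funM.
  - by move=> i w _; rewrite lee_fin mulr_ge0.
apply: (@le_trans _ _ (c%:E + \sum_i (l i)%:E)%E).
  apply: leeD2l; apply: lee_sum => i _.
  under eq_integral do rewrite EFinM.
  rewrite ge0_integralZl//; first last.
  - by rewrite lee_fin.
  - by move=> w _; rewrite lee_fin.
  - exact/measurable_EFinP.
  rewrite -[leRHS]mule1 lee_wpmul2l//; first by rewrite lee_fin.
  by have [_ _ /(_ P tau HP st Pfin)] := eM i; rewrite unlock.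
by rewrite sumEFin -EFinD lee_fin /c subrK.
Qed.

(** * Admissible mergers are neutral affine *)

(** The convex cone generated by the points (x - 1, F x - 1), for x in the
    orthant. *)
Definition excess_cone {R : realType} {S : finType} (F : (S -> R) -> R)
    (u : S -> R) (v : R) : Prop :=
  exists s : seq ({nonneg R} * (S -> {nonneg R})),
    (forall i, u i = \sum_(p <- s) p.1%:num * ((p.2 i)%:num - 1)) /\
    v = \sum_(p <- s) p.1%:num * (F (fun i => (p.2 i)%:num) - 1).

(** [merger_finite_mean] made homogeneous: the total mass t of the weights is
    arbitrary, so one divides by it. When t = 0 all weights vanish. *)
Lemma excess_cone_neg (R : realType) (S : finType) (F : (S -> R) -> R) u v :
  is_pointwise_merger F -> excess_cone F u v -> (forall i, u i <= 0) -> v <= 0.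
Proof.
move=> mergeF [s [uE ->]] u0.
have sumB (f : {nonneg R} * (S -> {nonneg R}) -> R) :
    \sum_(p <- s) p.1%:num * (f p - 1) =
    \sum_(p <- s) p.1%:num * f p - \sum_(p <- s) p.1%:num.
  by rewrite -sumrB; apply: eq_bigr => p _; rewrite mulrBr mulr1.
pose t := \sum_(p <- s) p.1%:num.
have t0 : 0 <= t by apply: sumr_ge0 => p _.
move: (t0); rewrite le_eqVlt => /orP[/eqP/esym/eqP|tgt0].
  rewrite psumr_eq0 => [/allP s0|p _]; last by [].
  by rewrite big1_seq// => p /andP[_ /s0 /= /eqP ->]; rewrite mul0r.
have div_ge0 (c : {nonneg R}) : 0 <= c%:num / t by rewrite divr_ge0.
pose s' := [seq (NngNum (div_ge0 p.1), p.2) | p <- s].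
have sumE (f : (S -> {nonneg R}) -> R) :
    \sum_(p <- s') p.1%:num * f p.2 = (\sum_(p <- s) p.1%:num * f p.2) / t.
  by rewrite big_map mulr_suml; apply: eq_bigr => p _; rewrite /= mulrAC.
have := @merger_finite_mean _ _ _ s' mergeF.
rewrite (sumE (fun y => F (fun i => (y i)%:num))).
rewrite ler_pdivrMr// mul1r sumB subr_le0; apply.
  rewrite big_map /= -mulr_suml divff//; exact: lt0r_neq0.
move=> i; rewrite (sumE (fun y => (y i)%:num)) ler_pdivrMr// mul1r.
by have := u0 i; rewrite uE sumB subr_le0.
Qed.

Lemma merger_le_affine (R : realType) (S : finType) (F : (S -> R) -> R) :
  is_pointwise_merger F ->
  exists l : S -> R, [/\ forall i, 0 <= l i, \sum_i l i <= 1 &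
    forall x, orthant x -> F x <= neutral_affine l x].
Proof.
move=> mergeF.
have coneF x : orthant x -> excess_cone F (fun i => x i - 1) (F x - 1).
  move=> x0; exists [:: (1%:nng, fun i => NngNum (x0 i))].
  by split=> [i|]; rewrite big_seq1/= mul1r.
have F0 : 0 <= F (fun=> 0).
  by have [[Fge0 _ _] _] := mergeF; apply: Fge0.
have [l [l0 lP]] : exists l : S -> R, (forall i, 0 <= l i) /\
    forall u v, excess_cone F u v -> v <= \sum_(i <- enum S) l i * u i.
  apply: cone_supporting_functional.
  - exact: enum_uniq.
  - move=> u v u' v' [s [uE ->]] [s' [uE' ->]]; exists (s ++ s').
    by split=> [i|]; rewrite big_cat// uE uE'.
  - move=> a u v a0 [s [uE ->]].
    exists [seq (((NngNum (ltW a0))%:num * p.1%:num)%:nng, p.2) | p <- s].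
    split=> [i|]; rewrite big_map ?uE mulr_sumr; apply: eq_bigr => p _ /=;
      by rewrite mulrA.
  (* the Slater point, generated by x = 0 *)
  - exists (fun i => 0 - 1), (F (fun=> 0) - 1); split.
      exact: (coneF (fun=> 0)).
    by move=> i _; rewrite sub0r oppr_lt0.
  - move=> u v Cuv u0; apply: (excess_cone_neg mergeF Cuv) => i.
    by apply: u0; rewrite mem_enum.
have le_aff x : orthant x -> F x <= neutral_affine l x.
  by move=> /coneF /lP; rewrite big_enum /= lerBlDl.
exists l; split=> //.
have := le_trans F0 (le_aff _ (fun=> lexx 0)).
by rewrite neutral_affineE [X in _ + X]big1 ?addr0 ?subr_ge0// => i _; rewrite mulr0.
Qed.

Lemma admissible_eq_affine (R : realType) (S : finType) (F : (S -> R) -> R) :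
  is_admissible F ->
  exists l : S -> R, [/\ forall i, 0 <= l i, \sum_i l i <= 1 &
    forall x, orthant x -> F x = neutral_affine l x].
Proof.
move=> [mergeF maxF]; have [l [l0 l1 Fl]] := merger_le_affine mergeF.
exists l; split=> // x x0; apply/eqP; rewrite eq_le Fl//= leNgt.
apply/negP => ltF; apply: maxF; exists (neutral_affine l); split=> //.
  exact: neutral_affine_merger.
by exists x.
Qed.

(** * Coherence identifies the weights *)

(** Vectors that differ from the all-ones vector in one coordinate isolate the
    slope in that coordinate. Both the padding of a constant on a singleton
    ([pad_one_singleton]) and that constant itself ([const_singleton]) have this
    shape. *)
Lemma neutral_affine_spike (R : realType) (K : choiceType) (S : {fset K})
    (l : S -> R) (i : S) (c : R) :
  neutral_affine l (fun k => if val k == val i then c else 1) =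
  1 + l i * (c - 1).
Proof.
rewrite /neutral_affine (bigD1 i)//= eqxx big1 ?addr0// => k ki.
by rewrite (inj_eq val_inj) (negbTE ki) subrr mulr0.
Qed.

Lemma pad_one_singleton (R : realType) (K : choiceType) (S : {fset K}) (i : K)
    (c : R) :
  pad_one S (fun _ : [fset i] => c) = fun k => if val k == i then c else 1.
Proof.
apply/funext => k; rewrite /pad_one; case: insubP => [j|].
  by rewrite in_fset1 => -> _.
by rewrite in_fset1 => /negbTE ->.
Qed.

Lemma const_singleton (R : realType) (K : choiceType) (i : K) (c : R) :
  (fun _ : [fset i] => c) = fun k : [fset i] => if val k == i then c else 1.
Proof.
by apply/funext => k; have := valP k; rewrite in_fset1 => ->.
Qed.

(** A padded coordinate equals 1, so its term w_k (1 - 1) vanishes. *)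
Lemma sum_pad_one (R : realType) (K : choiceType) (B S : {fset K}) (w : K -> R)
    (x : B -> R) : (B `<=` S)%fset ->
  \sum_(k : S) w (val k) * (pad_one S x k - 1) =
  \sum_(k : B) w (val k) * (x k - 1).
Proof.
move=> BS.
pose g (a : K) := if insub a is Some j then w a * ((x : B -> R) j - 1) else 0.
transitivity (\sum_(k : S) g (val k)).
  apply: eq_bigr => k _; rewrite /g /pad_one.
  by case: insub => [j //|]; rewrite subrr mulr0.
rewrite -(big_seq_fsetE _ _ xpredT g)/= -(big_fset_incl _ BS).
  rewrite (big_seq_fsetE _ _ xpredT g)/=; apply: eq_bigr => k _.
  by rewrite /g valK.
by move=> a _ aB; rewrite /g insubN.
Qed.

Lemma weight_family_singleton (R : realType) (I : set nat)
    (F : forall S : {fset I}, (S -> R) -> R) (w : I -> R) (i : I) (c : R) :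
  is_weight_family F w -> 0 <= c -> F [fset i] (fun=> c) = 1 + w i * (c - 1).
Proof.
move=> [_ _ Fw] c0; rewrite (const_singleton i c) Fw; first last.
- by move=> k; case: ifP.
- by apply/fset0Pn; exists i; rewrite fset11.
exact: (neutral_affine_spike (fun k => w (val k)) [` fset11 i] c).
Qed.

(** With m the slope of the rule for {i}, coherence at the constant c reads
    m (c - 1) <= l_i (c - 1); c = 2 gives m <= l_i and c = 0 gives m >= l_i. *)
Lemma coherent_weights (R : realType) (I : set nat)
    (F : forall S : {fset I}, (S -> R) -> R) (S : {fset I}) (l : S -> R) (i : S) :
  (forall B : {fset I}, B != fset0 -> is_admissible (F B)) ->
  (forall (B S : {fset I}) (x : B -> R),
    B != fset0 -> (B `<=` S)%fset -> orthant x -> F B x <= F S (pad_one S x)) ->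
  (forall x, orthant x -> F S x = neutral_affine l x) ->
  l i = F [fset val i] (fun=> 2) - 1.
Proof.
move=> admF cohF FS.
have B0 : [fset val i] != fset0 by apply/fset0Pn; exists (val i); rewrite fset11.
have BS : ([fset val i] `<=` S)%fset by rewrite fsub1set (valP i).
have [m [_ _ FB]] := admissible_eq_affine (admF _ B0).
pose b : [fset val i] := [` fset11 (val i)].
have FBc c : 0 <= c -> F [fset val i] (fun=> c) = 1 + m b * (c - 1).
  move=> c0; rewrite (const_singleton (val i) c) FB; last by move=> k; case: ifP.
  exact: (neutral_affine_spike m b).
have le_c c : 0 <= c -> 1 + m b * (c - 1) <= 1 + l i * (c - 1).
  move=> c0; rewrite -FBc// (le_trans (cohF _ _ (fun=> c) B0 BS _))//.
  rewrite pad_one_singleton FS; first by rewrite neutral_affine_spike.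
  by move=> k; case: ifP.
have := le_c 0 (lexx 0); have := le_c 2 (ler0n R 2).
rewrite FBc//; lra.
Qed.

Theorem theorem4p8 (R : realType) (I : set nat)
    (F : forall S : {fset I}, (S -> R) -> R)
    (F_admissible : forall S : {fset I}, S != fset0 -> is_admissible (F S))
    (F_coherent : forall (B S : {fset I}) (x : B -> R),
      B != fset0 -> (B `<=` S)%fset -> orthant x ->
      F B x <= F S (pad_one S x)) :
  [/\ exists! w : I -> R, is_weight_family F w,
      forall (B S : {fset I}) (x : B -> R),
        B != fset0 -> (B `<=` S)%fset -> orthant x ->
        F S (pad_one S x) = F B x &
      forall w : I -> R, is_weight_family F w -> forall i : I,
        w i = F [fset i] (fun=> 2) - 1 /\ w i = 1 - F [fset i] (fun=> 0)].
Proof.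
have identify w : is_weight_family F w -> forall i : I,
    w i = F [fset i] (fun=> 2) - 1 /\ w i = 1 - F [fset i] (fun=> 0).
  by move=> Fw i; rewrite !(weight_family_singleton i Fw)//; lra.
pose w (i : I) := F [fset i] (fun=> 2) - 1.
have affine (S : {fset I}) : S != fset0 ->
    [/\ forall i : S, 0 <= w (val i), \sum_(i : S) w (val i) <= 1 &
      forall x, orthant x -> F S x = 1 + \sum_(i : S) w (val i) * (x i - 1)].
  move=> S0; have [l [l0 l1 Fl]] := admissible_eq_affine (F_admissible S S0).
  have lw : l = fun i => w (val i).
    by apply/funext => i; apply: (coherent_weights i F_admissible F_coherent Fl).
  by rewrite lw in l0 l1 Fl.
have Fw : is_weight_family F w.
  split=> [i||S x S0]; last by have [_ _] := affine S S0; apply.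
    have [] := affine [fset i]; first by apply/fset0Pn; exists i; rewrite fset11.
    by move=> /(_ [` fset11 i]).
  apply: ub_ereal_sup => _ [A [finA _] <-].
  rewrite fsbig_finite//= big_seq_fsetE/= sumEFin lee_fin.
  have [S0|/affine[] //] := eqVneq (fset_set A) fset0.
  by rewrite big1 ?ler01// => -[a aA]; exfalso; rewrite S0 in_fset0 in aA.
split=> //.
- exists w; split=> // w' Fw'; apply/funext => i.
  by rewrite (identify w' Fw' i).1.
- move=> B S x B0 BS x0.
  have S0 : S != fset0.
    by move: B0 => /fset0Pn[a /(fsubsetP BS) aS]; apply/fset0Pn; exists a.
  have [_ _ Fval] := Fw.
  rewrite !Fval// ?sum_pad_one// => k; rewrite /pad_one.
  by case: insub.
Qed.
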